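(* Let $n\geq 1$ and $p\in(0,1)$. For any boolean function $f:\{0,1\}^n\to\{0,1\}$ with $P(f=1)>0$, we have $$P(f=1)\,\leq\,2\exp\Big(-\frac12\sum_{1\leq i\leq n}\Big(p(1-p)\,E\big(X_i f\,\big|\,f=1\big)\Big)^2\Big)\,.$$
   Context: Let $\Omega=\{0,1\}^n$, with elements $\omega=(\omega(1),\dots,\omega(n))$. The probability $P$ on $\Omega$ is the Bernoulli product measure of parameter $p$: $P(\omega)=\prod_{1\leq i\leq n}p^{\omega(i)}(1-p)^{1-\omega(i)}$, and $E$ is the expectation with respect to $P$. A boolean function is any function $f:\Omega\to\{0,1\}$ (no monotonicity is assumed here). For $i\in\{1,\dots,n\}$, the random variable $X_i$ is defined on $\Omega$ by $X_i(\omega)=\dfrac{\omega(i)}{p}-\dfrac{1-\omega(i)}{1-p}$. For a random variable $Y$ on $\Omega$, $E(Y\,|\,f=1)$ denotes the elementary conditional expectation $\frac{1}{P(f=1)}\sum_{\omega:\,f(\omega)=1}Y(\omega)P(\omega)$. *)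

(* Defs.v *)
From mathcomp Require Import all_boot all_order all_algebra.
From mathcomp Require Import reals.
Set Implicit Arguments.
Unset Strict Implicit.
Unset Printing Implicit Defensive.
Import Order.TTheory GRing.Theory Num.Theory.
Local Open Scope ring_scope.

(* [cube n] is {0,1}^n; [true] stands for 1, read as a number through the
   coercion of [bool] into [nat]. *)
Definition cube (n : nat) : finType := {ffun 'I_n -> bool}.

Definition bernoulli_weight (R : realType) (n : nat) (p : R) (w : cube n) : R :=
  \prod_(i < n) (p ^+ w i * (1 - p) ^+ (1 - w i)%N).

Definition Prob (R : realType) (n : nat) (p : R) (A : {set cube n}) : R :=
  \sum_(w in A) bernoulli_weight p w.

(* Only meaningful when [Prob p A] is nonzero. *)
Definition cond_expect (R : realType) (n : nat) (p : R) (Y : cube n -> R)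
    (A : {set cube n}) : R :=
  (Prob p A)^-1 * \sum_(w in A) Y w * bernoulli_weight p w.

Definition X (R : realType) (n : nat) (p : R) (i : 'I_n) (w : cube n) : R :=
  (w i)%:R / p - (1 - (w i)%:R) / (1 - p).

(* Main.v *)
Require Import Defs.
From mathcomp Require Import all_boot all_order all_algebra.
From mathcomp Require Import reals sequences exp.
From mathcomp Require Import ring lra.
Set Implicit Arguments.
Unset Strict Implicit.
Unset Printing Implicit Defensive.
Import Order.TTheory GRing.Theory Num.Theory.
Local Open Scope ring_scope.

(** Put [A = {f = 1}] and [a i = E(w i - p | A)], which is the quantity squared
    in the statement since [p (1 - p) X i w = w i - p]. Let
    [Y w = \sum_i a i (w i - p)] and [S = \sum_i (a i)^2], so that
    [E(Y | A) = S]. Jensen's inequality on [A], then independence, give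
    [exp S <= E(exp Y | A) <= E(exp Y) / P(A) <= exp (S / 2) / P(A)],
    hence [P(A) <= exp (- S / 2)], without the factor 2. *)

(** Serves the two values [a (1 - p)] and [- a p] of [a (b - p)]. The coefficient 2 still suffices
    there, since [2 p (1 - p) <= 1 / 2]. *)
Lemma expR_le_quadratic (R : realType) (x : R) : x <= 1 ->
  expR x <= 1 + x + 2 * x ^+ 2.
Proof.
move=> x1; set q := 1 + x + 2 * x ^+ 2.
(* [exp (- x / 2) >= 1 - x / 2], squared. *)
have h : (1 - x / 2) ^+ 2 <= expR (- x).
  have -> : expR (- x) = expR (- x / 2) ^+ 2.
    by rewrite expr2 -expRD; congr expR; lra.
  have := expR_ge1Dx (- x / 2); have := expR_gt0 (- x / 2); nra.
have q0 : 0 <= q by rewrite /q; nra.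
have qe : 1 <= q * expR (- x).
  apply: le_trans (ler_wpM2l q0 h).
  (* Both linear factors on the right are nonnegative exactly because [x <= 1]. *)
  have -> : q * (1 - x / 2) ^+ 2
          = 1 + x ^+ 2 * ((1 - x) * (5 / 4 - x / 2)) by rewrite /q; field.
  by rewrite lerDl mulr_ge0 ?sqr_ge0// mulr_ge0//; lra.
by rewrite expRN ler_pdivlMr ?expR_gt0// mul1r in qe.
Qed.

(** With the quadratic bound on each exponential, the linear terms cancel because [b - p] is
    centered, leaving [1 + 2 a^2 p (1 - p)], at most [1 + a^2 / 2]. *)
Lemma bernoulli_mgf_le (R : realType) (p a : R) :
  0 < p -> p < 1 -> `|a| <= 1 ->
  \sum_(b : bool) p ^+ b * (1 - p) ^+ (1 - b)%N * expR (a * (b%:R - p))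
  <= expR (a ^+ 2 / 2).
Proof.
move=> p0 p1; rewrite ler_norml => /andP[a0 a1].
rewrite big_bool /= !expr1 !expr0 mulr1 mul1r sub0r.
apply: le_trans (expR_ge1Dx _).
have h1 := @expR_le_quadratic R (a * (1 - p)) ltac:(nra).
have h0 := @expR_le_quadratic R (a * - p) ltac:(nra).
have k1 := ler_wpM2l (ltW p0) h1.
have q0 : 0 <= 1 - p by lra.
have k0 := ler_wpM2l q0 h0.
apply: le_trans (lerD k1 k0) _.
(* Half this square is the gap [a^2 / 2 - 2 a^2 p (1 - p)]. *)
have := sqr_ge0 (a * (1 - 2 * p)); nra.
Qed.

Lemma bernoulli_weight_ge0 (R : realType) (n : nat) (p : R) (w : cube n) :
  0 < p -> p < 1 -> 0 <= bernoulli_weight p w.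
Proof.
move=> p0 p1; apply: prodr_ge0 => i _.
by rewrite mulr_ge0 ?exprn_ge0 ?subr_ge0// ltW.
Qed.

Lemma mgf_le (R : realType) (n : nat) (p : R) (a : 'I_n -> R) :
  0 < p -> p < 1 -> (forall i, `|a i| <= 1) ->
  \sum_(w : cube n) bernoulli_weight p w
    * expR (\sum_(i < n) a i * ((w i)%:R - p))
  <= expR ((\sum_(i < n) a i ^+ 2) / 2).
Proof.
move=> p0 p1 a1.
under eq_bigr do rewrite /bernoulli_weight expR_sum -big_split /=.
(* Independence: the sum over the cube of a product over coordinates is the product of the
   one-coordinate sums. *)
rewrite -(bigA_distr_bigA (fun i (b : bool) =>
  p ^+ b * (1 - p) ^+ (1 - b)%N * expR (a i * (b%:R - p)))) /=.
rewrite mulr_suml expR_sum; apply: ler_prod => i _.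
rewrite bernoulli_mgf_le// andbT sumr_ge0// => b _.
by rewrite !mulr_ge0 ?exprn_ge0 ?expR_ge0 ?subr_ge0// ltW.
Qed.

Lemma cond_expect_centered (R : realType) (n : nat) (p : R)
    (f : cube n -> bool) (i : 'I_n) : 0 < p -> p < 1 ->
  p * (1 - p) * cond_expect p (fun w => X p i w * (f w)%:R) [set w | f w]
  = cond_expect p (fun w => (w i)%:R - p) [set w | f w].
Proof.
move=> p0 p1; rewrite /cond_expect mulrCA; congr (_ * _).
rewrite mulr_sumr; apply: eq_bigr => w; rewrite inE => ->.
by rewrite /X mulr1 mulrA; congr (_ * _); field; rewrite subr_eq0 !gt_eqF.
Qed.

Lemma cond_expect_sum (R : realType) (n : nat) (p : R) (I : finType)
    (a : I -> R) (Y : I -> cube n -> R) (A : {set cube n}) :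
  cond_expect p (fun w => \sum_i a i * Y i w) A
  = \sum_i a i * cond_expect p (Y i) A.
Proof.
rewrite /cond_expect; under eq_bigr do rewrite mulr_suml.
rewrite exchange_big mulr_sumr; apply: eq_bigr => i _.
rewrite [RHS]mulrCA; congr (_ * _); rewrite mulr_sumr.
by apply: eq_bigr => w _; rewrite mulrA.
Qed.

Lemma norm_cond_expect_le (R : realType) (n : nat) (p c : R)
    (Y : cube n -> R) (A : {set cube n}) : 0 < p -> p < 1 ->
  0 < Prob p A -> (forall w, `|Y w| <= c) -> `|cond_expect p Y A| <= c.
Proof.
move=> p0 p1 A0 Yc; rewrite /cond_expect normrM normfV (gtr0_norm A0).
rewrite ler_pdivrMl// mulrC (le_trans (ler_norm_sum _ _ _))//.
rewrite mulr_sumr ler_sum// => w _.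
have w0 := bernoulli_weight_ge0 w p0 p1.
by rewrite normrM (ger0_norm w0) ler_wpM2r.
Qed.

(* Average the tangent inequality [exp m * (1 + Y - m) <= exp Y]. *)
Lemma expR_cond_expect_le (R : realType) (n : nat) (p : R)
    (Y : cube n -> R) (A : {set cube n}) : 0 < p -> p < 1 -> 0 < Prob p A ->
  expR (cond_expect p Y A) * Prob p A
  <= \sum_(w in A) bernoulli_weight p w * expR (Y w).
Proof.
move=> p0 p1 A0; set m := cond_expect p Y A.
have mE : \sum_(w in A) Y w * bernoulli_weight p w = m * Prob p A.
  by rewrite /m /cond_expect mulrC mulVKf ?gt_eqF.
have -> : expR m * Prob p A
    = \sum_(w in A) bernoulli_weight p w * (expR m * (1 + (Y w - m))).
  (* Isolates [m * Prob p A], which [mE] turns into the sum of [Y] over [A]. *)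
  transitivity (expR m * ((1 - m) * Prob p A + m * Prob p A)); first by ring.
  rewrite -mE /Prob [_ * \sum_(w in A) _]mulr_sumr -big_split mulr_sumr /=.
  by apply: eq_bigr => w _; ring.
apply: ler_sum => w _; rewrite ler_wpM2l ?bernoulli_weight_ge0//.
rewrite -[Y w in leRHS](subrKC m) expRD.
by rewrite ler_wpM2l ?expR_ge0 ?expR_ge1Dx.
Qed.

Theorem proposition10p1 (R : realType) (n : nat) (p : R) (f : cube n -> bool)
    (hn : (1 <= n)%N) (hp0 : 0 < p) (hp1 : p < 1)
    (hf : 0 < Prob p [set w | f w]) :
  Prob p [set w | f w] <=
    2 * expR (- (1 / 2) *
      \sum_(i < n)
        (p * (1 - p) *
         cond_expect p (fun w => X p i w * (f w)%:R) [set w | f w]) ^+ 2).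
Proof.
under eq_bigr do rewrite cond_expect_centered//.
set A := [set w | f w] in hf *.
pose a (i : 'I_n) := cond_expect p (fun w : cube n => (w i)%:R - p) A.
rewrite -/(a _); set S := \sum_(i < n) _.
(* An average of values in [[-1, 1]]; this is the range of coefficients that [mgf_le] accepts. *)
have a1 i : `|a i| <= 1.
  apply: norm_cond_expect_le => // w.
  by rewrite ler_norml; case: (w i) => /=; apply/andP; split; lra.
have SE : cond_expect p
    (fun w : cube n => \sum_(i < n) a i * ((w i)%:R - p)) A = S.
  by rewrite cond_expect_sum; apply: eq_bigr => i _; rewrite expr2.
have PS : expR S * Prob p A <= expR (S / 2).
  rewrite -[in X in X <= _]SE.
  apply: le_trans (mgf_le hp0 hp1 a1).
  apply: le_trans (expR_cond_expect_le _ hp0 hp1 hf) _.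
  (* Extending the sum from [A] to the whole cube adds only nonnegative terms. *)
  rewrite [leRHS](bigID (mem A)) /= lerDl sumr_ge0// => w _.
  by rewrite mulr_ge0 ?expR_ge0 ?bernoulli_weight_ge0.
have -> : - (1 / 2) * S = - S + S / 2 by field.
rewrite expRD expRN.
have le1 : Prob p A <= (expR S)^-1 * expR (S / 2).
  by rewrite ler_pdivlMl ?expR_gt0.
(* Since [Prob p A] is positive, so is the bound in [le1], and doubling it only enlarges it. *)
by have := lt_le_trans hf le1; lra.
Qed.
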